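(* Each of the following families of games is domestic but not tame, and returnable but not forced: Knight on the set of all nonempty subpartitions of generalized staircases; Knight on the set of all nonempty partitions.
   Context: A partition is a finite weakly decreasing sequence $\lambda=[\lambda_1,\ldots,\lambda_r]$ of positive integers; $[\,]$ is the empty partition, and $\mathbb Y^+$ is the set of nonempty partitions. For $i,j\ge 0$, $\lambda[i,j]=[\lambda_{i+1}-j,\lambda_{i+2}-j,\ldots]$ with trailing nonpositive entries removed. For a moveset $M\subseteq \mathbb Z_{\ge0}^2\setminus\{(0,0)\}$ and $\lambda\in\mathbb Y^+$, the impartial chess game $(M,\lambda)$ starts at $\lambda$, and from a position $\mu\in\mathbb Y^+$ a player may move to $\mu[i,j]$ for any $(i,j)\in M$ with $\mu[i,j]\ne[\,]$. The positions of $(M,\lambda)$ are the partitions reachable from $\lambda$ by zero or more moves. A position is terminal if it has no moves. Knight has moveset $\{(1,2),(2,1)\}$. The generalized staircase with parameters $r,c,k\ge1$ is $[(kc)^r,((k-1)c)^r,\ldots,c^r]$ (exponents denote repetition). A nonempty subpartition of a generalized staircase $\lambda$ is a partition $\lambda[i,j]\neq[\,]$ with $i,j\ge0$. The Sprague-Grundy value of a position $p$ is $\mathrm{mex}$ of the Sprague-Grundy values of the positions reachable in one move ($0$ if $p$ is terminal), where $\mathrm{mex}(S)$ is the least nonnegative integer not in $S$. The misère Grundy value is defined by the same mex recursion at non-terminal positions, but terminal positions have value $1$. A position with Sprague-Grundy value $t$ and misère Grundy value $\ell$ is called a $(t,\ell)$-position. A game is returnable if for any move from a $(0,1)$-position (resp.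 a $(1,0)$-position) to a non-terminal position $y$, there is a move from $y$ to a $(0,1)$-position (resp. to a $(1,0)$-position). A game is forced if each move from a $(0,1)$-position results in a $(1,0)$-position and each move from a $(1,0)$-position results in a $(0,1)$-position. A game is domestic if it has neither $(0,k)$-positions nor $(k,0)$-positions with $k\ge2$. A game is tame if it has only $(0,1)$-positions, $(1,0)$-positions, and $(k,k)$-positions with $k\ge0$. For a moveset $M$ and a set $P\subseteq\mathbb Y^+$, the family $(M,P)$ has one of these properties if $(M,\lambda)$ has it for every $\lambda\in P$, and it does not have the property if $(M,\lambda)$ fails it for at least one $\lambda\in P$. *)

(* Defs.v *)
From mathcomp Require Import all_boot.

Set Implicit Arguments.
Unset Strict Implicit.
Unset Printing Implicit Defensive.

Definition is_partition (la : seq nat) : bool := sorted geq la && (0 \notin la).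

Definition nonempty_partition (la : seq nat) : Prop :=
  is_partition la /\ la <> [::].

(* The partition la[i,j]; on a weakly decreasing sequence the entries that
   become nonpositive are exactly a tail, so filtering removes that tail. *)
Definition subpart (la : seq nat) (i j : nat) : seq nat :=
  [seq x - j | x <- drop i la & j < x].

Record moveset := Moveset {
  in_moveset :> pred (nat * nat);
  _ : ~~ in_moveset (0, 0) }.

Definition move (M : moveset) (mu nu : seq nat) : Prop :=
  exists i j, [/\ M (i, j), nu = subpart mu i j & nu <> [::]].

Definition terminal (M : moveset) (mu : seq nat) : Prop :=
  forall nu, ~ move M mu nu.

Inductive position (M : moveset) (la : seq nat) : seq nat -> Prop :=
| position_start : position M la la
| position_move mu nu :
    position M la mu -> move M mu nu -> position M la nu.

(* For a partition mu, mu[i,j] is empty when i >= size mu or j >= head 0 mu,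
   so this finite list contains all options (see optionsP). *)
Definition options (M : moveset) (mu : seq nat) : seq (seq nat) :=
  [seq nu <- [seq subpart mu ij.1 ij.2 |
               ij <- allpairs pair (iota 0 (size mu)) (iota 0 (head 0 mu)) & M ij]
  | nu != [::]].

Definition mex (s : seq nat) : nat :=
  find (fun n => n \notin s) (iota 0 (size s).+1).

(* Mex recursion in which terminal positions get the value v.  A move
   decreases the sum of the parts, so sumn mu is enough fuel. *)
Fixpoint grundy_rec (v : nat) (M : moveset) (n : nat) (mu : seq nat) : nat :=
  if n is n'.+1 then
    let os := options M mu in
    if os is [::] then v else mex (map (grundy_rec v M n') os)
  else v.

Definition grundy_from (v : nat) (M : moveset) (mu : seq nat) : nat :=
  grundy_rec v M (sumn mu) mu.

Definition sprague_grundy : moveset -> seq nat -> nat := grundy_from 0.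
Definition misere_grundy : moveset -> seq nat -> nat := grundy_from 1.

Definition is_tl (M : moveset) (t l : nat) (mu : seq nat) : Prop :=
  sprague_grundy M mu = t /\ misere_grundy M mu = l.

Definition returnable (M : moveset) (la : seq nat) : Prop :=
  forall x y, position M la x -> move M x y -> ~ terminal M y ->
    (is_tl M 0 1 x -> exists z, move M y z /\ is_tl M 0 1 z) /\
    (is_tl M 1 0 x -> exists z, move M y z /\ is_tl M 1 0 z).

Definition forced (M : moveset) (la : seq nat) : Prop :=
  forall x y, position M la x -> move M x y ->
    (is_tl M 0 1 x -> is_tl M 1 0 y) /\ (is_tl M 1 0 x -> is_tl M 0 1 y).

Definition domestic (M : moveset) (la : seq nat) : Prop :=
  forall x k, position M la x -> 2 <= k -> ~ is_tl M 0 k x /\ ~ is_tl M k 0 x.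

Definition tame (M : moveset) (la : seq nat) : Prop :=
  forall x, position M la x ->
    [\/ is_tl M 0 1 x, is_tl M 1 0 x | exists k, is_tl M k k x].

Definition family_has (Q : moveset -> seq nat -> Prop)
    (M : moveset) (P : seq nat -> Prop) : Prop :=
  forall la, P la -> Q M la.

Definition family_lacks (Q : moveset -> seq nat -> Prop)
    (M : moveset) (P : seq nat -> Prop) : Prop :=
  exists la, P la /\ ~ Q M la.

Definition knight : moveset :=
  @Moveset (fun ij => ij \in [:: (1, 2); (2, 1)]) isT.

Definition gen_staircase (r c k : nat) : seq nat :=
  flatten [seq nseq r ((k - m) * c) | m <- iota 0 k].

Definition staircase_subpartition (la : seq nat) : Prop :=
  exists r c k i j,
    [/\ 1 <= r, 1 <= c, 1 <= k, la = subpart (gen_staircase r c k) i j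
      & la <> [::]].

Lemma mexP (s : seq nat) :
  mex s \notin s /\ (forall n, n < mex s -> n \in s).
Proof.
have has_s : has (fun n => n \notin s) (iota 0 (size s).+1).
  apply/negP => /negP/hasPn h.
  have := @uniq_leq_size _ (iota 0 (size s).+1) s (iota_uniq _ _).
  rewrite size_iota ltnn => H; suff: false by [].
  by apply: H => x /h; rewrite negbK.
have lt_s : mex s < (size s).+1 by rewrite -[X in _ < X](size_iota 0) -has_find.
split; first by have := nth_find 0 has_s; rewrite nth_iota.
move=> n n_lt; have := before_find 0 n_lt.
by rewrite nth_iota ?(ltn_trans n_lt lt_s) // add0n => /negbFE.
Qed.

Lemma partition_le_head (mu : seq nat) x :
  is_partition mu -> x \in mu -> x <= head 0 mu.
Proof.
case: mu => // a s /andP[/= + _]; rewrite inE.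
rewrite (path_sortedE (fun b a c => (fun h1 h2 => leq_trans h2 h1))).
by case/andP=> /allP h _ /orP[/eqP->|/h].
Qed.

Lemma optionsP (M : moveset) (mu nu : seq nat) :
  is_partition mu -> reflect (move M mu nu) (nu \in options M mu).
Proof.
move=> part_mu; rewrite mem_filter; apply: (iffP andP).
  case=> /eqP nz /mapP[[i j]]; rewrite mem_filter => /andP[Mij _] def_nu.
  by exists i, j; split.
case=> i [j [Mij def_nu nz]]; split; first exact/eqP.
apply/mapP; exists (i, j) => //; rewrite mem_filter Mij /=.
have [x]: exists x, x \in [seq x <- drop i mu | j < x].
  move: nz; rewrite def_nu /subpart.
  case: [seq x <- drop i mu | j < x] => [[] // | x s _].
  by exists x; rewrite inE eqxx.
rewrite mem_filter => /andP[j_lt x_in].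
apply/allpairsP; exists (i, j); split=> //=; rewrite mem_iota add0n /=.
  by rewrite ltnNge; apply/negP => /drop_oversize E; rewrite E in x_in.
exact: leq_trans j_lt (partition_le_head part_mu (mem_drop x_in)).
Qed.

Lemma subpart_partition (mu : seq nat) i j :
  is_partition mu -> is_partition (subpart mu i j).
Proof.
case/andP=> so _; apply/andP; split.
  apply: (@homo_sorted _ _ (subn^~ j) geq geq).
    by move=> a b /= ?; apply: leq_sub2r.
  apply: sorted_filter; first by move=> b a c /= h1 h2; apply: leq_trans h2 h1.
  exact: drop_sorted.
by apply/mapP => -[x]; rewrite mem_filter -subn_gt0 => /andP[+ _] E; rewrite -E.
Qed.

Lemma sumn_subpart (mu : seq nat) i j : sumn (subpart mu i j) <= sumn mu.
Proof.
rewrite /subpart.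
apply: leq_trans (_ : sumn (drop i mu) <= _); last first.
  by rewrite -[X in _ <= sumn X](cat_take_drop i) sumn_cat leq_addl.
elim: (drop i mu) => //= x s IH; case: ifP => _ /=.
  by rewrite leq_add ?leq_subr.
exact: leq_trans IH (leq_addl _ _).
Qed.

Lemma sumn_move (M : moveset) (mu nu : seq nat) :
  is_partition mu -> move M mu nu -> sumn nu < sumn mu.
Proof.
case: M => M M0 part_mu [i [j [/= Mij -> nz]]].
case: mu part_mu nz => [|a s]; first by rewrite /subpart.
case/andP=> _; rewrite inE negb_or => /andP[a_nz _] nz.
case: i Mij nz => [|i] Mij nz.
  case: j Mij nz => [|j] Mij nz; first by rewrite Mij in M0.
  have le_s := sumn_subpart s 0 j.+1; rewrite /subpart drop0 in le_s.
  rewrite /subpart /=; case: ifP => _ /=; last first.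
    apply: leq_ltn_trans le_s _.
    by rewrite -[X in X < _]add0n ltn_add2r lt0n eq_sym.
  rewrite -addSn; apply: leq_add le_s.
  by rewrite ltn_subrL /= lt0n eq_sym.
apply: leq_ltn_trans (sumn_subpart s i j) _.
by rewrite /= -[X in X < _]add0n ltn_add2r lt0n eq_sym.
Qed.

Lemma grundy_rec_fuel v (M : moveset) n mu :
  is_partition mu -> sumn mu <= n -> grundy_rec v M n mu = grundy_from v M mu.
Proof.
rewrite /grundy_from; move: mu; elim/ltn_ind: n => -[|n] IH mu part_mu.
  by rewrite leqn0 => /eqP ->.
move=> le_n; case E: (sumn mu) => [|m] /=.
  case E': (options M mu) => [//|nu os].
  have: nu \in options M mu by rewrite E' inE eqxx.
  by move/(optionsP M nu part_mu)/(sumn_move part_mu); rewrite E.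
case E': (options M mu) => [//|nu0 os0]; rewrite -E'; congr mex.
apply/eq_in_map => nu /(optionsP M nu part_mu) mv.
have part_nu : is_partition nu.
  by case: mv => i [j [_ -> _]]; apply: subpart_partition.
have lt_nu := sumn_move part_mu mv; rewrite E ltnS in lt_nu.
rewrite E ltnS in le_n.
rewrite (IH n) ?(IH m) //.
exact: leq_trans lt_nu le_n.
Qed.

Lemma grundy_fromE v (M : moveset) (mu : seq nat) :
  is_partition mu ->
  (terminal M mu -> grundy_from v M mu = v) /\
  (~ terminal M mu ->
     grundy_from v M mu = mex [seq grundy_from v M nu | nu <- options M mu]).
Proof.
move=> part_mu.
rewrite -(@grundy_rec_fuel v M (sumn mu).+1 mu part_mu (leqnSn _)) /=.
case E: (options M mu) => [|nu os].
  split=> // nt; case: nt => nu mv.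
  by have /(optionsP M nu part_mu) := mv; rewrite E.
rewrite -E; split=> [t | _].
  by case: (t nu); apply/(optionsP M nu part_mu); rewrite E inE eqxx.
congr mex; apply/eq_in_map => ka /(optionsP M ka part_mu) mv.
apply: grundy_rec_fuel; last exact/ltnW/(sumn_move part_mu mv).
by case: mv => i [j [_ -> _]]; apply: subpart_partition.
Qed.

(* Main.v *)
Require Import Defs.
From mathcomp Require Import all_boot.

Set Implicit Arguments.
Unset Strict Implicit.
Unset Printing Implicit Defensive.

(** From mu Knight can only reach a := mu[1,2] and b := mu[2,1], whose options
    mu[2,4], mu[3,3], mu[4,2] share the middle one.  If a or b is missing, none
    of these three exists; if mu[3,3] is missing, no position is three moves
    away.  Under these two constraints, the (t, l)-types of the at most four
    positions three moves away determine whether mu is domestic and returnable,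
    and there are finitely many combinations of types to check, since by
    induction the positions after mu are domestic.  The staircase with
    (r, c, k) = (3, 4, 4) is a (1, 0)-position with a move to a
    (2, 1)-position. *)

(** * Iterated subpartitions, and invariance of mex *)

Lemma subpart0s i j : subpart [::] i j = [::].
Proof. by []. Qed.

Lemma subpart_subpart mu i j i' j' :
  sorted geq mu ->
  subpart (subpart mu i j) i' j' = subpart mu (i + i') (j + j').
Proof.
move=> mu_sorted; rewrite /subpart [i + i']addnC -drop_drop.
have: sorted geq (drop i mu) by apply: drop_sorted.
move: (drop i mu) => s s_sorted.
(* Dropping commutes with filtering because in a decreasing list the entries at most [j] form a
   tail: once the head is at most [j], both sides are empty. *)
have -> : drop i' [seq x - j | x <- s & j < x]
    = [seq x - j | x <- drop i' s & j < x].
  elim: s i' s_sorted => [|x s IHs] [|i'] //= s_sorted; first by rewrite drop0.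
  case: ltnP => [_|le_xj]; first exact/IHs/(path_sorted s_sorted).
  have geq_trans : transitive geq by move=> y u v /= le_yu /leq_trans; apply.
  have small (t : seq nat) : {subset t <= s} -> [seq y <- t | j < y] = [::].
    move=> sub; apply/eqP; rewrite -[_ == _]negbK -has_filter.
    apply/hasPn => y /sub ys; rewrite -leqNgt; apply: leq_trans le_xj.
    by move: s_sorted; rewrite (path_sortedE geq_trans) => /andP[/allP/(_ y ys)].
  by rewrite !small //; apply: mem_drop.
rewrite filter_map -filter_predI -map_comp.
rewrite (@eq_filter _ _ (fun x => j + j' < x)); last first.
  by move=> x /=; apply/andP/idP => [[]|]; rewrite ltn_subRL //;
     move=> lt; split=> //; apply: leq_ltn_trans lt; apply: leq_addr.
by apply: eq_map => x /=; rewrite subnDA.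
Qed.

Lemma eq_mex s t : s =i t -> mex s = mex t.
Proof.
move=> eq_st; have [s_out s_in] := mexP s; have [t_out t_in] := mexP t.
case: (ltngtP (mex s) (mex t)) => // [/t_in|/s_in].
  by rewrite -eq_st (negPf s_out).
by rewrite eq_st (negPf t_out).
Qed.

Lemma position_partition M la mu :
  is_partition la -> position M la mu -> is_partition mu.
Proof.
move=> part_la; elim=> // {}mu nu _ part_mu [i [j [_ -> _]]].
exact: subpart_partition.
Qed.

Lemma knight_moveE mu nu :
  move knight mu nu <->
  nu <> [::] /\ (nu = subpart mu 1 2 \/ nu = subpart mu 2 1).
Proof.
split=> [[i [j [/= + ->]]]|[nz [] def_nu]].
- by rewrite !inE => /orP[] /eqP[-> ->]; auto.
- by exists 1, 2.
- by exists 2, 1.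
Qed.

Lemma knight_terminalE mu :
  terminal knight mu <-> subpart mu 1 2 = [::] /\ subpart mu 2 1 = [::].
Proof.
split=> [term|[a0 b0] nu /knight_moveE[]]; last by rewrite a0 b0 => ? [].
by split; apply/eqP/negPn/negP => /eqP nz;
   [apply: (term (subpart mu 1 2))|apply: (term (subpart mu 2 1))];
   apply/knight_moveE; auto.
Qed.

(** [None] is the type of the empty partition, which is not a position. *)
Definition tl_type (mu : seq nat) : option (nat * nat) :=
  if mu == [::] then None
  else Some (sprague_grundy knight mu, misere_grundy knight mu).

Definition mex_type (o o' : option (nat * nat)) : nat * nat :=
  let os := pmap id [:: o; o'] in
  if os is [::] then (0, 1) else (mex (unzip1 os), mex (unzip2 os)).

(** The flag [b] tells whether the partition is nonempty. The option types do not determine this: if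
    both are [None], the partition is empty or terminal. *)
Definition node (b : bool) (o o' : option (nat * nat)) : option (nat * nat) :=
  if b then Some (mex_type o o') else None.

Lemma tl_type_node mu :
  is_partition mu ->
  tl_type mu =
  node (mu != [::]) (tl_type (subpart mu 1 2)) (tl_type (subpart mu 2 1)).
Proof.
move=> part_mu; rewrite /tl_type /node.
case: eqVneq => //= mu_nz; congr Some.
set a := subpart mu 1 2; set b := subpart mu 2 1.
have [[sg0 sgS] [mg0 mgS]] :=
  (grundy_fromE 0 knight part_mu, grundy_fromE 1 knight part_mu).
have options_ab : options knight mu =i [seq nu <- [:: a; b] | nu != [::]].
  move=> nu; rewrite mem_filter !inE; apply/(optionsP knight nu part_mu)/andP.
    by move=> /knight_moveE[/eqP nz [] def_nu]; rewrite {2 3}def_nu eqxx ?orbT.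
  by case=> /eqP nz /orP[] /eqP def_nu; apply/knight_moveE; split=> //;
     [left|right].
have mexE v : mex [seq grundy_from v knight nu | nu <- options knight mu]
    = mex [seq grundy_from v knight nu | nu <- [:: a; b] & nu != [::]].
  exact/eq_mex/eq_mem_map.
have nterm : ~~ ((a == [::]) && (b == [::])) -> ~ terminal knight mu.
  by move=> nz /knight_terminalE[a0 b0]; rewrite /a /b a0 b0 in nz.
rewrite /sprague_grundy /misere_grundy /mex_type /=.
have [a0|a_nz] := eqVneq a [::]; have [b0|b_nz] := eqVneq b [::] => /=.
- by rewrite sg0 ?mg0 //; apply/knight_terminalE.
all: rewrite sgS ?mgS;
  try by apply: nterm; rewrite ?a0 ?(negPf a_nz) ?(negPf b_nz) ?andbF.
all: by rewrite !mexE /= ?a0 ?b0 ?a_nz ?b_nz.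
Qed.

(** * The finite check on types *)

(** A mex of at most two values is at most 2, so besides [None] these are all pairs over 0, 1, 2
    except (0, 2) and (2, 0). *)
Definition domestic_types : seq (option (nat * nat)) :=
  [:: None; Some (0, 1); Some (1, 0); Some (0, 0); Some (1, 1); Some (2, 2);
      Some (1, 2); Some (2, 1)].

(** If [mu] has type [z], then an option with options of types [o] and [o'] is
    terminal or has an option of type [z]. *)
Definition return_to (z : nat * nat) (o o' : option (nat * nat)) : bool :=
  [|| (o == None) && (o' == None), o == Some z | o' == Some z].

(** Written with [if] because [vm_compute] would evaluate both sides of [==>]. *)
Definition local_check (ba bb b0 b1 b2 : bool) (p q r s : option (nat * nat)) :=
  let c0 := node b0 p q in let c1 := node b1 q r in let c2 := node b2 r s in
  let a := node ba c0 c1 in let b := node bb c1 c2 in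
  let x := mex_type a b in
  if all (fun o => o \in domestic_types) [:: c0; c1; c2; a; b] then
    (Some x \in domestic_types) &&
    (if x \in [:: (0, 1); (1, 0)] then return_to x c0 c1 && return_to x c1 c2
     else true)
  else true.

(** The flags stand for nonemptiness of mu[1,2], mu[2,1], mu[2,4], mu[3,3], mu[4,2], and [p], [q],
    [r], [s] for the types of mu[3,6], mu[4,5], mu[5,4], mu[6,3]. *)
Definition feasible (ba bb b0 b1 b2 : bool) (p q r s : option (nat * nat)) :=
  (if ba && bb then true else ~~ [|| b0, b1 | b2]) &&
  (if b1 then true else all (eq_op^~ None) [:: p; q; r; s]).

Definition bools := [:: true; false].

Lemma local_checkT :
  all (fun ba => all (fun bb => all (fun b0 => all (fun b1 => all (fun b2 =>
  all (fun p => all (fun q => all (fun r => all (fun s =>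
    if feasible ba bb b0 b1 b2 p q r s then local_check ba bb b0 b1 b2 p q r s
    else true)
  domestic_types) domestic_types) domestic_types) domestic_types)
  bools) bools) bools) bools) bools.
Proof. by vm_compute. Qed.

Lemma mem_bools b : b \in bools.
Proof. by case: b. Qed.

Lemma local_analysis mu :
  is_partition mu -> mu <> [::] ->
  (forall i j, tl_type (subpart mu i.+1 j) \in domestic_types) ->
  let ty i j := tl_type (subpart mu i j) in
  (tl_type mu \in domestic_types) /\
  (forall z, z \in [:: (0, 1); (1, 0)] -> tl_type mu = Some z ->
     return_to z (ty 2 4) (ty 3 3) /\ return_to z (ty 3 3) (ty 4 2)).
Proof.
move=> part_mu /eqP mu_nz dom ty.
have sorted_mu : sorted geq mu by case/andP: part_mu.
have partS i j : is_partition (subpart mu i j) by apply: subpart_partition.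
pose ne i j := subpart mu i j != [::].
have tyE i j : ty i j = node (ne i j) (ty (i + 1) (j + 2)) (ty (i + 2) (j + 1)).
  by rewrite /ty tl_type_node // !subpart_subpart.
have empty i j i' j' : i <= i' -> j <= j' -> ~~ ne i j -> ~~ ne i' j'.
  move=> le_i le_j /negPn/eqP ij0; apply/negPn/eqP.
  by rewrite -(subnKC le_i) -(subnKC le_j) -subpart_subpart // ij0 subpart0s.
have ty0 i j : ~~ ne i j -> ty i j = None by rewrite tyE => /negPf->.
(* Emptiness passes to larger indices: (2,4), (3,3), (4,2) each dominate both (1,2) and (2,1), and
   all four index pairs three moves away dominate (3,3). *)
have feas : feasible (ne 1 2) (ne 2 1) (ne 2 4) (ne 3 3) (ne 4 2)
                     (ty 3 6) (ty 4 5) (ty 5 4) (ty 6 3).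
  apply/andP; split.
    case: ifP => // /negbT; rewrite negb_and !negb_or.
    by case/orP=> e; rewrite !(empty _ _ _ _ _ _ e).
  by case: ifP => //= /negbT e; rewrite !ty0 //; apply: empty e.
have := local_checkT.
move=> /allP/(_ _ (mem_bools (ne 1 2)))/allP/(_ _ (mem_bools (ne 2 1))).
move=> /allP/(_ _ (mem_bools (ne 2 4)))/allP/(_ _ (mem_bools (ne 3 3))).
move=> /allP/(_ _ (mem_bools (ne 4 2)))/allP/(_ _ (dom 2 6)).
move=> /allP/(_ _ (dom 3 5))/allP/(_ _ (dom 4 4)).
move=> /allP/(_ _ (dom 5 3)); rewrite feas.
rewrite /local_check -(tyE 2 4) -(tyE 3 3) -(tyE 4 2) -(tyE 1 2) -(tyE 2 1).
(* The guard of [local_check] holds by [dom], as all five intermediate positions have a positive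
   first index. *)
rewrite [tl_type mu]tl_type_node // mu_nz /node ifT; last first.
  by rewrite /= !dom.
case/andP=> domx ret; split=> // z z01 [def_z].
by move: ret; rewrite -/(ty 1 2) -/(ty 2 1) in def_z *; rewrite def_z z01 => /andP.
Qed.

(** * Domesticity and returnability on all partitions *)

Lemma tl_type_domestic mu : is_partition mu -> tl_type mu \in domestic_types.
Proof.
(* Induction on the number of parts: mu[i+1,j] has fewer parts whatever [j] is. *)
have [n] := ubnP (size mu); elim: n mu => // n IHn mu lt_n part_mu.
have [-> //|/eqP mu_nz] := eqVneq mu [::].
have [] // := local_analysis part_mu mu_nz.
move=> i j; apply: IHn; last exact: subpart_partition.
rewrite size_map size_filter.
apply: leq_ltn_trans (count_size _ _) _; rewrite size_drop.
rewrite ltnS in lt_n; apply: leq_trans lt_n.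
by case: mu mu_nz {part_mu} => //= x mu _; rewrite subSS !ltnS leq_subr.
Qed.

Lemma is_tlP mu t l :
  mu <> [::] -> is_tl knight t l mu <-> tl_type mu = Some (t, l).
Proof.
rewrite /is_tl /tl_type => /eqP/negPf->.
by split=> [[-> ->]|[-> ->]].
Qed.

Lemma tl_type_Some mu z :
  tl_type mu = Some z -> mu <> [::] /\ is_tl knight z.1 z.2 mu.
Proof.
case: z => t l def_z; have nz : mu <> [::] by move=> mu0; rewrite mu0 in def_z.
by split=> //; apply/is_tlP.
Qed.

Lemma knight_domestic : family_has domestic knight nonempty_partition.
Proof.
move=> la [part_la la_nz] x k pos_x k_ge2.
have part_x := position_partition part_la pos_x.
have x_nz : x <> [::] by case: pos_x => // mu nu _ [i [j []]].
have := tl_type_domestic part_x.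
case: k k_ge2 => [|[|[|k]]] // _ dom_x;
  by split=> /(is_tlP _ _ x_nz) eq_x; rewrite eq_x in dom_x.
Qed.

Lemma knight_returnable : family_has returnable knight nonempty_partition.
Proof.
move=> la [part_la la_nz] x y pos_x mv_xy nterm_y.
have part_x := position_partition part_la pos_x.
have x_nz : x <> [::] by case: pos_x => // mu nu _ [i [j []]].
have sorted_x : sorted geq x by case/andP: part_x.
have ret z : z \in [:: (0, 1); (1, 0)] -> is_tl knight z.1 z.2 x ->
    exists w, move knight y w /\ is_tl knight z.1 z.2 w.
  move=> z01 /(is_tlP _ _ x_nz); rewrite -surjective_pairing => def_z.
  have dom i j : tl_type (subpart x i.+1 j) \in domestic_types.
    exact/tl_type_domestic/subpart_partition.
  have [_ /(_ z z01 def_z) ret_ab] := local_analysis part_x x_nz dom.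
  (* The options of x[1,2] are x[2,4] and x[3,3]; those of x[2,1] are x[3,3] and x[4,2]. *)
  have {ret_ab}: return_to z (tl_type (subpart y 1 2)) (tl_type (subpart y 2 1)).
    move/knight_moveE: mv_xy => [_ []] ->; rewrite !subpart_subpart //.
      exact: ret_ab.1.
    exact: ret_ab.2.
  case/or3P=> [/andP[a0 b0]|/eqP def_w|/eqP def_w].
  - case: nterm_y; apply/knight_terminalE; move: a0 b0; rewrite /tl_type.
    by case: (subpart y 1 2); case: (subpart y 2 1).
  - have [nz tl_w] := tl_type_Some def_w.
    by exists (subpart y 1 2); split=> //; apply/knight_moveE; auto.
  - have [nz tl_w] := tl_type_Some def_w.
    by exists (subpart y 2 1); split=> //; apply/knight_moveE; auto.
by split=> tl_x; [apply: (ret (0, 1))|apply: (ret (1, 0))].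
Qed.

(** * Generalized staircases as partitions *)

Lemma gen_staircaseS r c k :
  gen_staircase r c k.+1 = nseq r (k.+1 * c) ++ gen_staircase r c k.
Proof.
rewrite /gen_staircase /= subn0 -[1]addn0 iotaDl -map_comp.
by congr (_ ++ flatten _); apply: eq_map => m /=; rewrite add1n subSS.
Qed.

Lemma gen_staircase_bounds r c k x :
  1 <= c -> x \in gen_staircase r c k -> 0 < x <= k * c.
Proof.
move=> c_gt0; elim: k => [|k IHk]; first by rewrite /gen_staircase.
rewrite gen_staircaseS mem_cat mem_nseq => /orP[/andP[_ /eqP->]|/IHk/andP[-> le_x]].
  by rewrite muln_gt0 c_gt0 leqnn.
by rewrite (leq_trans le_x) // leq_mul2r leqnSn orbT.
Qed.

Lemma gen_staircase_partition r c k :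
  1 <= c -> is_partition (gen_staircase r c k).
Proof.
move=> c_gt0; apply/andP; split; last first.
  by apply/negP => /(gen_staircase_bounds c_gt0).
(* The pairwise form splits over [++], so a new block need only be compared with the bounds on the
   smaller staircase. *)
rewrite sorted_pairwise; last by move=> y u v /= le_yu /leq_trans; apply.
elim: k => [|k IHk] //; rewrite gen_staircaseS pairwise_cat IHk andbT.
apply/andP; split.
  apply/allrelP => x y /nseqP[-> _] /(gen_staircase_bounds c_gt0)/andP[_ le_y].
  by rewrite /= (leq_trans le_y) // leq_mul2r leqnSn orbT.
by elim: r {IHk} => //= r ->; rewrite andbT all_nseq /= leqnn orbT.
Qed.

(** By this inclusion, positive results descend from all partitions to staircases, and
    counterexamples carry over the other way. *)
Lemma staircase_subpartition_nonempty la :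
  staircase_subpartition la -> nonempty_partition la.
Proof.
move=> [r [c [k [i [j [_ c_gt0 _ -> nz]]]]]]; split=> //.
exact/subpart_partition/gen_staircase_partition.
Qed.

Lemma family_has_sub Q M (P P' : seq nat -> Prop) :
  (forall la, P la -> P' la) -> family_has Q M P' -> family_has Q M P.
Proof. by move=> sPP' QP' la /sPP'/QP'. Qed.

Lemma family_lacks_sub Q M (P P' : seq nat -> Prop) :
  (forall la, P la -> P' la) -> family_lacks Q M P -> family_lacks Q M P'.
Proof. by move=> sPP' [la [/sPP' Pla nQla]]; exists la. Qed.

(** * A staircase that is neither tame nor forced *)

Lemma staircase_344 : staircase_subpartition (gen_staircase 3 4 4).
Proof. by exists 3, 4, 4, 0, 0; split. Qed.

Lemma move_344 :
  move knight (gen_staircase 3 4 4) (subpart (gen_staircase 3 4 4) 1 2).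
Proof. by exists 1, 2. Qed.

Lemma is_tl_344 : is_tl knight 1 0 (gen_staircase 3 4 4).
Proof. by split; vm_compute. Qed.

(** This type refutes both properties: no tame game contains it, and forcedness would require (0, 1)
    after the (1, 0)-position. *)
Lemma is_tl_344_move : is_tl knight 2 1 (subpart (gen_staircase 3 4 4) 1 2).
Proof. by split; vm_compute. Qed.

Lemma staircase_not_tame : family_lacks tame knight staircase_subpartition.
Proof.
exists (gen_staircase 3 4 4); split; first exact: staircase_344.
have [sg mg] := is_tl_344_move.
move/(_ _ (position_move (position_start _ _) move_344)); rewrite /is_tl sg mg.
by case=> [[]|[]|[k [<-]]].
Qed.

Lemma staircase_not_forced : family_lacks forced knight staircase_subpartition.
Proof.
exists (gen_staircase 3 4 4); split; first exact: staircase_344.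
move/(_ _ _ (position_start _ _) move_344) => [_ /(_ is_tl_344)].
by rewrite /is_tl (is_tl_344_move).1 => -[].
Qed.

Theorem theorem4p14 :
  [/\ family_has domestic knight staircase_subpartition,
      family_lacks tame knight staircase_subpartition,
      family_has returnable knight staircase_subpartition
    & family_lacks forced knight staircase_subpartition] /\
  [/\ family_has domestic knight nonempty_partition,
      family_lacks tame knight nonempty_partition,
      family_has returnable knight nonempty_partition
    & family_lacks forced knight nonempty_partition].
Proof.
have sub := staircase_subpartition_nonempty.
split; split.
- exact: family_has_sub sub knight_domestic.
- exact: staircase_not_tame.
- exact: family_has_sub sub knight_returnable.
- exact: staircase_not_forced.
- exact: knight_domestic.
- exact: family_lacks_sub sub staircase_not_tame.
- exact: knight_returnable.
- exact: family_lacks_sub sub staircase_not_forced.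
Qed.
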